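(* Let $n\ge 2$ and $\mathbf{x}\in\mathbb{R}^n$, and let $\mathbf{B}_{\mathbf{x}}=\mathbf{C}_{\mathbf{x}}^\top\mathbf{C}_{\mathbf{x}}$. If $\mathbf{x}\in\mathcal{C}_n'$, then there exists an $m_0\in\mathbb{N}$ such that $\mathbf{B}_{\mathbf{x}}^m>\mathbf{0}$ for all $m\ge m_0$.
   Context: $\mathbb{N}=\{1,2,3,\dots\}$. For $\mathbf{x}=(x_0,\dots,x_{n-1})\in\mathbb{R}^n$, $\mathbf{C}_{\mathbf{x}}\in\mathbb{R}^{n\times n}$ is the circulant matrix with first row $(x_0,x_1,\dots,x_{n-1})$, each further row being the cyclic shift to the right by one position of the row above; i.e. the entry in row $j$, column $k$ ($0\le j,k\le n-1$) is $x_{(k-j)\bmod n}$. For a matrix $\mathbf{M}$, $\mathbf{M}>\mathbf{0}$ means that every entry of $\mathbf{M}$ is positive. $\|\cdot\|$ denotes the spectral norm of a matrix (the matrix norm induced by the Euclidean norm). Let $c(t)=x_0+x_1t+\dots+x_{n-1}t^{n-1}$ and $\mathbb{T}_n=\{t\in\mathbb{C}:t^n=1\}$. Define $\mathcal{C}_n=\{\mathbf{x}\in\mathbb{R}^n:\ \|\mathbf{C}_{\mathbf{x}}\|=|x_0+x_1+\dots+x_{n-1}|\}$ and, for $n\ge2$, $\mathcal{C}_n'=\{\mathbf{x}\in\mathcal{C}_n:\ \max_{t\in\mathbb{T}_n\setminus\{1\}}|c(t)|<|c(1)|\}$. *)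

(* Defs.v *)
From HB Require Import structures.
From mathcomp Require Import all_boot all_order all_algebra.
From mathcomp Require Import complex.
From mathcomp Require Import classical_sets reals.

Set Implicit Arguments.
Unset Strict Implicit.
Unset Printing Implicit Defensive.

Import Order.TTheory GRing.Theory Num.Theory.

Local Open Scope classical_set_scope.
Local Open Scope ring_scope.
Local Open Scope complex_scope.

(* (k - j) mod n.  Since j < n, n - j is not truncated; adding n first avoids
   the truncation of k - j when k < j.  The proof uses j only to know 0 < n. *)
Definition cyc_sub (n : nat) (k j : 'I_n) : 'I_n :=
  Ordinal (ltn_pmod (k + (n - j)) (leq_ltn_trans (leq0n j) (ltn_ord j))).

Definition circ (R : realType) (n : nat) (x : 'rV[R]_n) : 'M[R]_n :=
  \matrix_(j < n, k < n) x 0 (cyc_sub k j).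

Definition mx_pos (R : realType) (m n : nat) (M : 'M[R]_(m, n)) : Prop :=
  forall i j, 0 < M i j.

(* MathComp-Analysis puts the sup norm on matrices, hence an explicit
   Euclidean norm. *)
Definition enorm (R : realType) (n : nat) (v : 'cV[R]_n) : R :=
  Num.sqrt (\sum_(i < n) v i 0 ^+ 2).

Definition spectral_norm (R : realType) (m n : nat) (A : 'M[R]_(m, n)) : R :=
  sup [set enorm (A *m v) | v in [set v : 'cV[R]_n | enorm v <= 1]].

Definition cpoly (R : realType) (n : nat) (x : 'rV[R]_n) (t : R[i]) : R[i] :=
  \sum_(i < n) (x 0 i)%:C * t ^+ i.

Definition unity_roots (R : realType) (n : nat) : set R[i] :=
  [set t | t ^+ n = 1].

(* The modulus as an element of R: the norm `|z| of R[i] is valued in R[i]. *)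
Definition cmod (R : realType) (z : R[i]) : R := ComplexField.Normc.normc z.

Definition class_C (R : realType) (n : nat) : set 'rV[R]_n :=
  [set x | spectral_norm (circ x) = `|\sum_(i < n) x 0 i|].

(* Meant for 2 <= n: the set of moduli is then finite and nonempty, so that its
   sup is its maximum. *)
Definition class_C' (R : realType) (n : nat) : set 'rV[R]_n :=
  [set x | class_C x /\
    sup [set cmod (cpoly x t) | t in @unity_roots R n `\ 1]
      < cmod (cpoly x 1)].

Definition Bmx (R : realType) (n : nat) (x : 'rV[R]_n) : 'M[R]_n :=
  (circ x)^T *m circ x.

(* Main.v *)
Require Import Defs.
From HB Require Import structures.
From mathcomp Require Import all_boot all_order all_algebra.
From mathcomp Require Import cyclic separable cyclotomic.
From mathcomp Require Import complex.
From mathcomp Require Import classical_sets reals topology normedtype sequences.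

Set Implicit Arguments.
Unset Strict Implicit.
Unset Printing Implicit Defensive.

Import Order.TTheory GRing.Theory Num.Theory.

Local Open Scope ring_scope.

(** The discrete Fourier basis diagonalizes every circulant matrix.  If
    z ^+ n = 1, then the column with entries z ^+ j is an eigenvector of
    [circ x] for c(z) = [cpoly x z] and of its transpose for c(z^-1), which is
    the conjugate of c(z) because x is real and z has modulus 1; hence it is an
    eigenvector of [Bmx x] for |c(z)|^2 ([Bmx_eigen]).  Letting z run through
    the powers of a primitive n-th root of unity w and using the orthogonality
    of these columns gives a closed formula for the entries of the powers
    ([entry_of_eigenvalues]):

      n (B^m)_{j,k} = sum_l |c(w^l)|^(2m) w^(l (j - k)).

    The term l = 0 is |c(1)|^(2m).  The moduli |c(w^l)|^(2m) of the
    other terms bound the deviation from it ([Bmx_entry_gap]), and each is at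
    most r^(2m), where r is the largest |c(t)| over the roots t != 1.  As r < |c(1)|, the first term eventually exceeds
    n r^(2m) ([eventually_exprM_lt]), hence the sum of all the others, and every
    entry is then positive, uniformly in (j, k). *)

(** The n roots of 'X^n - 1 are distinct, since the polynomial is separable when
    n is invertible, and n distinct n-th roots of unity in a field form a cyclic
    group. *)
Lemma prim_root_exists (F : closedFieldType) (n : nat) :
  n%:R != 0 :> F -> exists w : F, n.-primitive_root w.
Proof.
move=> nF0; have n_gt0 : (0 < n)%N by case: n nF0 => //; rewrite eqxx.
have [r Er] := closed_field_poly_normal ('X^n - 1 : {poly F}).
move: Er; rewrite (monicP (monicXnsubC 1 n_gt0)) scale1r => Er.
have r_uniq : uniq r by rewrite -separable_prod_XsubC -Er separable_Xn_sub_1.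
have r_root : all n.-unity_root r.
  by apply/allP=> z zr; rewrite /root_of_unity Er root_prod_XsubC.
have size_r : (n <= size r)%N.
  by rewrite -ltnS -(size_prod_XsubC r id) -Er size_XnsubC.
by have /hasP[w _ ww] := has_prim_root n_gt0 r_root r_uniq size_r; exists w.
Qed.

Lemma sum_unity_root (F : idomainType) (n : nat) (z : F) :
  z ^+ n = 1 -> z != 1 -> \sum_(l < n) z ^+ l = 0.
Proof.
move=> zn1 z1; apply/eqP; have := subrX1 z n.
by rewrite zn1 subrr => /esym/eqP; rewrite mulf_eq0 subr_eq0 (negPf z1).
Qed.

Section Fourier.
Variables (F : fieldType) (n : nat).

Definition power_col (z : F) : 'cV[F]_n := \col_j z ^+ j.

(** The sum is geometric, of ratio z = w ^+ k' / w ^+ k: since z ^+ n = 1, it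
    vanishes as soon as z != 1, and z = 1 only for k' = k because w is
    primitive. *)
Lemma prim_root_orthogonality (w : F) (k k' : 'I_n) : n.-primitive_root w ->
  \sum_(l < n) (w ^+ l) ^+ k' * (w ^+ l) ^- k = n%:R *+ (k' == k).
Proof.
move=> w_prim; have wn1 := prim_expr_order w_prim.
have n_gt0 := prim_order_gt0 w_prim.
have w0 : w != 0 by rewrite -unitfE -(unitrX_pos _ n_gt0) wn1 unitr1.
rewrite (eq_bigr (fun l : 'I_n => (w ^+ k' / w ^+ k) ^+ l)); last first.
  by move=> l _; rewrite expr_div_n !(exprAC w l).
have [->|k'k] := eqVneq k' k.
  rewrite divff ?expf_neq0 // (eq_bigr (fun=> 1)) => [|l _].
    by rewrite sumr_const card_ord mulr1n.
  by rewrite expr1n.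
rewrite mulr0n sum_unity_root //.
  by rewrite expr_div_n -!exprM ![(_ * n)%N]mulnC !exprM wn1 !expr1n divr1.
rewrite -(inj_eq (mulIf (expf_neq0 k w0))) divfK ?expf_neq0 // mul1r.
by rewrite (eq_prim_root_expr w_prim) !modn_small.
Qed.

(** Fourier inversion: n times the k-th basis vector is the combination of the
    columns [power_col (w ^+ l)] with coefficients (w ^+ l) ^- k, and M acts on
    each of these columns by a scalar. *)
Lemma entry_of_eigenvalues (w : F) (M : 'M[F]_n) (a : 'I_n -> F) (j k : 'I_n) :
    n.-primitive_root w ->
    (forall l : 'I_n, M *m power_col (w ^+ l) = a l *: power_col (w ^+ l)) ->
  n%:R * M j k = \sum_(l < n) a l * ((w ^+ l) ^+ j * (w ^+ l) ^- k).
Proof.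
move=> w_prim Ma.
transitivity (\sum_(l < n) (M *m power_col (w ^+ l)) j 0 * (w ^+ l) ^- k);
    last first.
  by apply: eq_bigr => l _; rewrite Ma !mxE mulrA.
under eq_bigr => l _ do rewrite mxE mulr_suml.
rewrite exchange_big (bigD1 k) //= [X in _ + X]big1 ?addr0 => [|k' k'k].
  under eq_bigr => l _ do rewrite [power_col _ _ _]mxE -mulrA.
  by rewrite -mulr_sumr prim_root_orthogonality // eqxx mulr1n mulrC.
under eq_bigr => l _ do rewrite [power_col _ _ _]mxE -mulrA.
by rewrite -mulr_sumr prim_root_orthogonality // (negPf k'k) mulr0n mulr0.
Qed.

End Fourier.

Lemma map_mxX_eigen (R F : comPzRingType) (f : {rmorphism R -> F}) (n m : nat)
    (A : 'M[R]_n) (v : 'cV[F]_n) (a : F) :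
  map_mx f A *m v = a *: v -> map_mx f (A ^+ m) *m v = a ^+ m *: v.
Proof.
move=> Av; elim: m => [|m IHm]; first by rewrite !expr0 map_mx1 mul1mx scale1r.
rewrite !exprS map_mxM -mulmxA IHm -scalemxAr Av scalerA; congr (_ *: _).
exact: mulrC.
Qed.

(** This congruence characterizes [cyc_sub]; the injectivity of [cyc_sub] in
    each argument and its effect on exponents of roots of unity follow from it
    alone. *)
Lemma cyc_subK (n : nat) (k j : 'I_n) : cyc_sub k j + j = k %[mod n].
Proof. by rewrite /= modnDml -addnA subnK ?modnDr // ltnW. Qed.

Lemma cyc_sub_injl (n : nat) (j : 'I_n) : injective (fun k => cyc_sub k j).
Proof.
move=> k1 k2 /= e; apply: val_inj => /=.
rewrite -(modn_small (ltn_ord k1)) -(modn_small (ltn_ord k2)).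
by rewrite -!(cyc_subK _ j) e.
Qed.

Lemma cyc_sub_injr (n : nat) (k : 'I_n) : injective (cyc_sub k).
Proof.
move=> j1 j2 e; apply: val_inj => /=.
rewrite -(modn_small (ltn_ord j1)) -(modn_small (ltn_ord j2)); apply/eqP.
by rewrite -(eqn_modDl (cyc_sub k j1)) [in X in _ == X %[mod _]]e !cyc_subK.
Qed.

Lemma expr_cyc_sub (F : fieldType) (n : nat) (z : F) (k j : 'I_n) :
  z ^+ n = 1 -> z ^+ cyc_sub k j * z ^+ j = z ^+ k.
Proof.
by move=> zn1; rewrite -exprD -(expr_mod _ zn1) cyc_subK (expr_mod _ zn1).
Qed.

Lemma cmod_ge0 (R : realType) (z : R[i]%C) : 0 <= cmod z.
Proof. by case: z => a b; apply: sqrtr_ge0. Qed.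

Section Circulant.
Variables (R : realType) (n : nat).
Hypothesis n_gt0 : (0 < n)%N.
Implicit Types (x : 'rV[R]_n) (z : R[i]).

Local Notation toC := (real_complex R).

Lemma unity_root_neq0 z : z ^+ n = 1 -> z != 0.
Proof. by move=> zn1; rewrite -unitfE -(unitrX_pos _ n_gt0) zn1 unitr1. Qed.

Lemma unity_root_norm z : z ^+ n = 1 -> `|z| = 1.
Proof.
by move=> zn1; apply/eqP; rewrite -(pexpr_eq1 n_gt0) // -normrX zn1 normr1.
Qed.

(** Along row j the substitution i = k - j mod n turns x_(k - j) z^k into
    x_i z^i z^j. *)
Lemma circ_eigen x z : z ^+ n = 1 ->
  map_mx toC (circ x) *m power_col n z = cpoly x z *: power_col n z.
Proof.
move=> zn1; apply/colP=> j; rewrite !mxE /cpoly mulr_suml.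
rewrite [RHS](reindex_inj (@cyc_sub_injl n j)) /=; apply: eq_bigr => k _.
by rewrite !mxE -mulrA expr_cyc_sub.
Qed.

(** Down column k the substitution i = k - j mod n turns x_(k - j) z^j into
    x_i z^(-i) z^k. *)
Lemma circ_tr_eigen x z : z ^+ n = 1 ->
  map_mx toC (circ x)^T *m power_col n z = cpoly x z^-1 *: power_col n z.
Proof.
move=> zn1; apply/colP=> k; rewrite !mxE /cpoly mulr_suml.
rewrite [RHS](reindex_inj (@cyc_sub_injr n k)) /=; apply: eq_bigr => j _.
rewrite !mxE -mulrA -(expr_cyc_sub k j zn1) exprVn.
by rewrite mulKf ?expf_neq0 ?unity_root_neq0.
Qed.

Lemma cpoly_inv x z : z ^+ n = 1 -> cpoly x z^-1 = ((cpoly x z)^*)%C.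
Proof.
move=> zn1; rewrite invc_norm (unity_root_norm zn1) expr1n invr1 mul1r /cpoly.
rewrite rmorph_sum; apply: eq_bigr => i _.
by rewrite rmorphM rmorphXn; congr (_ * _); exact/esym/conjc_real.
Qed.

Lemma Bmx_eigen x z : z ^+ n = 1 ->
  map_mx toC (Bmx x) *m power_col n z =
  toC (cmod (cpoly x z) ^+ 2) *: power_col n z.
Proof.
move=> zn1; rewrite /Bmx map_mxM -mulmxA circ_eigen // -scalemxAr.
rewrite circ_tr_eigen // scalerA cpoly_inv // -sqr_normc.
by rewrite rmorphXn; congr (_ *: _).
Qed.

(** This bound makes the set of moduli whose supremum defines [class_C']
    bounded, so that the supremum is an upper bound. *)
Lemma cmod_cpoly_le x z : z ^+ n = 1 ->
  cmod (cpoly x z) <= \sum_(i < n) `|x 0 i|.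
Proof.
move=> zn1; rewrite -lecR rmorph_sum /= -[leLHS]/`|cpoly x z|.
apply: (le_trans (ler_norm_sum _ _ _)); apply: ler_sum => i _.
rewrite normrM normrX (unity_root_norm zn1) expr1n mulr1.
by rewrite normc_def /= expr0n addr0 sqrtr_sqr.
Qed.

(** The real number on the left is, in the complex field, the sum over l != 0 of
    the eigenvalues to the power m times numbers of modulus 1. *)
Lemma Bmx_entry_gap x (w : R[i]) (m : nat) (j k : 'I_n) :
    n.-primitive_root w ->
  `|n%:R * (Bmx x ^+ m) j k - (cmod (cpoly x 1) ^+ 2) ^+ m|
    <= \sum_(l < n | val l != 0) (cmod (cpoly x (w ^+ l)) ^+ 2) ^+ m.
Proof.
move=> w_prim; have wl l : (w ^+ l) ^+ n = 1.
  by rewrite exprAC (prim_expr_order w_prim) expr1n.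
have E := entry_of_eigenvalues j k w_prim
  (fun l => map_mxX_eigen m (Bmx_eigen x (wl l))).
rewrite mxE (bigD1 (Ordinal n_gt0)) //= expr0 !expr1n invr1 !mulr1 in E.
have {}E : toC (n%:R * (Bmx x ^+ m) j k - (cmod (cpoly x 1) ^+ 2) ^+ m) =
    \sum_(l < n | l != Ordinal n_gt0) toC (cmod (cpoly x (w ^+ l)) ^+ 2) ^+ m *
      ((w ^+ l) ^+ j / (w ^+ l) ^+ k).
  by rewrite rmorphB rmorphM rmorph_nat E (rmorphXn _ m) /= addrAC subrr add0r.
rewrite -lecR.
have -> : toC `|n%:R * (Bmx x ^+ m) j k - (cmod (cpoly x 1) ^+ 2) ^+ m| =
    `|toC (n%:R * (Bmx x ^+ m) j k - (cmod (cpoly x 1) ^+ 2) ^+ m)|.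
  by rewrite normc_def /= expr0n addr0 sqrtr_sqr.
rewrite E rmorph_sum /=; apply: (le_trans (ler_norm_sum _ _ _)).
apply: ler_sum => l _; move: (w ^+ l) (wl l) => z zn1.
rewrite normrM normf_div !normrX (unity_root_norm zn1) !expr1n divr1 mulr1.
by rewrite (rmorphXn _ m) ger0_norm ?ler0c ?sqr_ge0.
Qed.

End Circulant.

Section GeometricGrowth.
Import numFieldNormedType.Exports.

(** The powers of p / s tend to 0, so they are eventually less than
    1 / (|c| + 1); the added 1 covers c = 0. *)
Lemma eventually_exprM_lt (R : realType) (c p s : R) :
  0 <= p -> p < s ->
  exists m0 : nat, (0 < m0)%N /\
    forall m : nat, (m0 <= m)%N -> c * p ^+ m < s ^+ m.
Proof.
move=> p_ge0 p_lt_s; have s_gt0 : 0 < s by apply: le_lt_trans p_lt_s.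
have ratio_lt1 : `|p / s| < 1.
  by rewrite ger0_norm ?divr_ge0 ?(ltW s_gt0) // ltr_pdivrMr // mul1r.
have c_gt0 : 0 < `|c| + 1 by rewrite ltr_wpDl.
have /cvgrPdist_lt /(_ (`|c| + 1)^-1) := cvg_expr ratio_lt1.
rewrite invr_gt0 => /(_ c_gt0) [m0 _ small].
exists m0.+1; split=> // m /ltnW /small /=.
rewrite sub0r normrN ger0_norm ?exprn_ge0 ?divr_ge0 ?(ltW s_gt0) //.
rewrite expr_div_n ltr_pdivrMr ?exprn_gt0 // mulrC ltr_pdivlMr // mulrC.
apply: le_lt_trans; apply: ler_wpM2r; first exact: exprn_ge0.
by rewrite (le_trans (ler_norm c)) // lerDl.
Qed.

End GeometricGrowth.

Theorem theorem2p2 (R : realType) (n : nat) (hn : (2 <= n)%N) (x : 'rV[R]_n)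
    (hx : class_C' x) :
  exists m0 : nat, (0 < m0)%N /\
    forall m : nat, (m0 <= m)%N -> mx_pos (Bmx x ^+ m).
Proof.
have n_gt0 : (0 < n)%N by apply: ltnW.
case: hx => _; set r := sup _ => r_lt.
have le_r t : t ^+ n = 1 -> t != 1 -> cmod (cpoly x t) <= r.
  move=> tn1 t1; apply: ub_le_sup; last first.
    by exists t => //; split => //= /eqP; apply/negP.
  exists (\sum_(i < n) `|x 0 i|) => _ [z [zn1 _] <-].
  exact: cmod_cpoly_le.
have [w w_prim] : exists w : R[i], n.-primitive_root w.
  by apply: prim_root_exists; rewrite pnatr_eq0 -lt0n.
have wl_neq1 (l : 'I_n) : val l != 0 -> w ^+ l != 1.
  by move=> l0; rewrite -(expr0 w) (eq_prim_root_expr w_prim) mod0n modn_small.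
have r_ge0 : 0 <= r.
  apply: (le_trans (cmod_ge0 (cpoly x (w ^+ 1%N)))); apply: le_r.
    by rewrite expr1 (prim_expr_order w_prim).
  exact: (wl_neq1 (Ordinal hn)).
have [m0 [m0_gt0 gap]] : exists m0 : nat, (0 < m0)%N /\
    forall m : nat, (m0 <= m)%N ->
      n%:R * (r ^+ 2) ^+ m < (cmod (cpoly x 1) ^+ 2) ^+ m.
  apply: eventually_exprM_lt; rewrite ?sqr_ge0 //.
  by rewrite ltrXn2r // (le_trans r_ge0 (ltW r_lt)).
exists m0; split=> // m /gap {}gap j k.
have n_gt0R : 0 < n%:R :> R by rewrite ltr0n.
rewrite -(pmulr_rgt0 _ n_gt0R).
have sum_le : \sum_(l < n | val l != 0) (cmod (cpoly x (w ^+ l)) ^+ 2) ^+ m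
    <= n%:R * (r ^+ 2) ^+ m.
  (* The missing index l = 0 is compared with 0 <= (r ^+ 2) ^+ m. *)
  rewrite mulr_natl -[n in X in _ <= X]card_ord -sumr_const big_mkcond.
  apply: ler_sum => l _; case: ifP => [l0|_]; last by rewrite exprn_ge0 ?sqr_ge0.
  rewrite lerXn2r ?nnegrE ?sqr_ge0 // lerXn2r ?nnegrE ?cmod_ge0 //.
  by rewrite le_r ?wl_neq1 // exprAC (prim_expr_order w_prim) expr1n.
have := le_lt_trans (le_trans (Bmx_entry_gap n_gt0 x m j k w_prim) sum_le) gap.
by rewrite ltr_norml => /andP[+ _]; rewrite ltrBrDl subrr.
Qed.
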